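(* Let $\mathcal{G}_{\mathrm{in}}$ be the class of all influence graphs $G=(V,E,p)$ that are in-arborescences. Then, for the influence maximization problem in the independent cascade model with full-adoption feedback, $$\sup_{G\in\mathcal{G}_{\mathrm{in}},\,k\ge 1}\frac{\mathrm{OPT}_A(G,k)}{\mathrm{OPT}_N(G,k)}\le \frac{2e}{e-1}.$$
   Context: Independent cascade (IC) model: an influence graph is a directed graph $G=(V,E,p)$ with $|V|=n$ and a probability $p_{uv}\in[0,1]$ on each edge $(u,v)\in E$. A live-edge graph (realization) $\phi$ is a random subgraph of $G$ on $V$ in which each edge $(u,v)$ is present (''live'') independently with probability $p_{uv}$; $\mathcal{P}$ denotes this distribution. For $S\subseteq V$, $\Gamma(S,\phi)$ is the set of nodes reachable from $S$ in $\phi$, and $\sigma(S)=\mathbb{E}_{\Phi\sim\mathcal{P}}[|\Gamma(S,\Phi)|]$. Full-adoption feedback: when a node $u$ is selected as a seed, one observes the live/blocked status of all out-going edges of every node reachable from $u$ in the realization. A partial realization $\psi$ records the seeds selected so far together with their observed feedback; ${\rm dom}(\psi)$ is the set of seeds selected so far. An adaptive policy $\pi$ maps partial realizations to the next node to select; $V(\pi,\phi)$ is the seed set it selects under realization $\phi$, and $\sigma(\pi)=\mathbb{E}_{\Phi\sim\mathcal{P}}[|\Gamma(V(\pi,\Phi),\Phi)|]$. $\Pi(k)$ is the set of policies with $|V(\pi,\phi)|\le k$ for every realization $\phi$. $\mathrm{OPT}_N(G,k)=\max_{S\subseteq V,|S|\le k}\sigma(S)$ and $\mathrm{OPT}_A(G,k)=\sup_{\pi\in\Pi(k)}\sigma(\pi)$.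 An in-arborescence is an influence graph whose underlying graph is a directed tree with a root $r$ such that for every node $v$ the unique path between $v$ and $r$ is directed from $v$ to $r$. *)

(* Defs.v *)
From HB Require Import structures.
From mathcomp Require Import all_boot all_order all_algebra.
From mathcomp Require Import all_classical all_reals.
From mathcomp.analysis Require Import sequences exp.
Set Implicit Arguments. Unset Strict Implicit. Unset Printing Implicit Defensive.
Import Order.TTheory GRing.Theory Num.Theory.
Local Open Scope ring_scope.

Section IC.
Variables (R : realType) (V : finType).

Definition edge_set (E : rel V) : {set V * V} := [set e | E e.1 e.2].

(* In-arborescence with root r: the underlying undirected graph of the
   directed graph E is a tree (no loops, no antiparallel pair, connected,
   |E| = |V| - 1), and every node v has a directed path from v to r
   (equivalently, the unique tree path between v and r is directed v -> r). *)
Definition is_in_arborescence (E : rel V) (r : V) : Prop :=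
  [/\ (forall v, ~~ E v v),
      (forall u v, E u v -> ~~ E v u),
      (forall u v, connect (fun x y => E x y || E y x) u v),
      (#|edge_set E| + 1 = #|V|)%N
    & (forall v, connect E v r)].

Definition realizations (E : rel V) : {set {set V * V}} := powerset (edge_set E).

Definition prob (E : rel V) (p : V -> V -> R) (phi : {set V * V}) : R :=
  \prod_(e in edge_set E) (if e \in phi then p e.1 e.2 else 1 - p e.1 e.2).

Definition reach (phi : {set V * V}) (S : {set V}) : {set V} :=
  [set v | [exists s in S, connect (fun x y => (x, y) \in phi) s v]].

Definition sigma (E : rel V) (p : V -> V -> R) (S : {set V}) : R :=
  \sum_(phi in realizations E) prob E p phi * #|reach phi S|%:R.

Definition OPT_N (E : rel V) (p : V -> V -> R) (k : nat) : R :=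
  \big[Num.max/0]_(S : {set V} | (#|S| <= k)%N) sigma E p S.

(* Partial realization: seeds selected so far and the observed status of
   edges (Some true = live, Some false = blocked, None = unobserved). *)
Record partial_realization := PR {
  pr_dom : {set V};
  pr_obs : V -> V -> option bool }.

Definition observe (E : rel V) (phi : {set V * V}) (S : {set V}) :
  partial_realization :=
  PR S (fun x y => if (x \in reach phi S) && E x y
                   then Some ((x, y) \in phi) else None).

(* Adaptive (deterministic) policy: next seed, or None = stop. *)
Definition policy := partial_realization -> option V.

Definition policy_step (pi : policy) (E : rel V) (phi : {set V * V})
  (S : {set V}) : {set V} :=
  if pi (observe E phi S) is Some v then v |: S else S.

(* V(pi, phi): the seed set selected by pi under phi (the seed sets grow
   until a fixpoint, reached after at most |V| steps). *)
Definition policy_seeds (pi : policy) (E : rel V) (phi : {set V * V}) :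
  {set V} := iter #|V| (policy_step pi E phi) finset.set0.

Definition in_Pi (E : rel V) (k : nat) (pi : policy) : Prop :=
  forall phi, phi \in realizations E -> (#|policy_seeds pi E phi| <= k)%N.

Definition sigma_pol (E : rel V) (p : V -> V -> R) (pi : policy) : R :=
  \sum_(phi in realizations E)
     prob E p phi * #|reach phi (policy_seeds pi E phi)|%:R.

Definition OPT_A (E : rel V) (p : V -> V -> R) (k : nat) : R :=
  sup [set sigma_pol E p pi | pi in [set pi | in_Pi E k pi]]%classic.

End IC.

(* Main.v *)
(* Work node by node. Fix a set S and a node u, and let M v be the probability
   that S misses u once the tree path from v to u is made live, so that the
   marginal gain of v at u is P(v reaches u) * M v. A policy reaches u by some
   first pick v; at that time it has seen no edge of the path from v to u, so this
   happens with probability at most P(v is a seed) * P(v reaches u).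

   The part of the policy's value not paid for by marginal gains is controlled by
   a non-adaptive estimate: if M v <= s^2 for all v in H, then
   (1 - s) P(H reaches u) <= P(S reaches u). It follows by induction on the tree
   from the supermultiplicativity of x |-> (x - t)/(1 - t x) on ]t, 1].
   Integrating it over s yields, with c = 2 ln 4 - 3/2 and x_v = P(v is a seed),
     9/16 sigma(pi) <= c sigma(S) + sum_v x_v (sigma(S + v) - sigma(S)).
   As sum_v x_v <= k, k greedy steps produce a seed set of influence at least
   9/16 (1 - e^-c)/c sigma(pi), and this factor exceeds (1 - 1/e)/2. *)

Require Import Defs.
From HB Require Import structures.
From mathcomp Require Import all_boot all_order all_algebra.
From mathcomp Require Import all_classical all_reals.
From mathcomp.analysis Require Import sequences exp.
From mathcomp.analysis Require Import topology normedtype.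
From mathcomp Require Import ring lra.
Import Order.TTheory GRing.Theory Num.Theory.
Local Open Scope ring_scope.

Set Implicit Arguments.
Unset Strict Implicit.
Unset Printing Implicit Defensive.

(** * Real inequalities *)

Section RealInequalities.
Variable R : realType.
Implicit Types x y z : R.

Lemma expR_ge_partial_sum z n : 0 <= z -> series (exp_coeff z) n <= expR z.
Proof.
move=> z0; apply: nondecreasing_cvgn_le; last exact: is_cvg_series_exp_coeff.
by apply/nondecreasing_seqP => m; rewrite /series /= big_nat_recr//= lerDl exp_coeff_ge0.
Qed.

(** The coefficient of z^i in (2 - z) e^z is (2 - i)/i!, which is nonpositive from i = 2 on; the
    first two terms are 2 + z. *)
Lemma expR_pade_le z : 0 <= z -> expR z * (2 - z) <= 2 + z.
Proof.
move=> z0; have [z2|z2] := leP 2 z.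
  by apply: (@le_trans _ _ 0); [rewrite mulr_ge0_le0 ?expR_ge0 //; lra | lra].
(* Truncating the series leaves the spurious top term - z^(n+2)/(n+1)!, which the added summand
   cancels. *)
have partial n : series (exp_coeff z) n.+2 * (2 - z) + z ^+ n.+2 / n.+1`!%:R <= 2 + z.
  elim: n => [|n IHn].
    rewrite /series /= !big_nat_recr//= big_geq // /exp_coeff /=.
    by rewrite !factS fact0 !muln1 !divr1 expr0 expr1 add0r; lra.
  apply: le_trans IHn; rewrite /series /= [in leLHS]big_nat_recr//= -/(series _ _).
  rewrite {2}/exp_coeff /= !(factS n.+1) natrM.
  have f0 : (0 : R) < n.+1`!%:R by rewrite ltr0n fact_gt0.
  have w0 : 0 <= z ^+ n.+2 / n.+1`!%:R by rewrite divr_ge0 ?exprn_ge0 // ltW.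
  rewrite (exprS z n.+2); move: f0 w0.
  set k : R := n.+2%:R; set F : R := n.+1`!%:R; set u := z ^+ n.+2.
  have k2 : 2 <= k by rewrite ler_nat.
  move=> f0 w0; rewrite -subr_ge0; set s := (X in X * (2 - z) + u / F).
  suff -> : s * (2 - z) + u / F - ((s + u / (k * F)) * (2 - z) + z * u / (k * F)) =
      u / F * ((k - 2) / k) by rewrite mulr_ge0 // divr_ge0 //; lra.
  by field; apply/andP; split; lra.
rewrite -ler_pdivlMr; last by lra.
apply: limr_le; first exact: is_cvg_series_exp_coeff.
exists 2%N => // -[|[|n]] //= _; rewrite ler_pdivlMr; last by lra.
apply: le_trans (partial n); rewrite lerDl divr_ge0 ?exprn_ge0 //.
Qed.

(** The Padé bound is sharp only near 0, so it is applied at 1/16 and then raised to the 16th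
    power. *)
Lemma expR1_le : expR 1 <= 272 / 100 :> R.
Proof.
have h : expR (1 / 16) <= 33 / 31 :> R.
  by have := @expR_pade_le (1 / 16) ltac:(lra); lra.
have -> : 1 = (1 / 16) * 16%:R :> R by lra.
rewrite expRM_natr; apply: (@le_trans _ _ ((33 / 31) ^+ 16)); last by lra.
by rewrite lerXn2r // ?nnegrE ?expR_ge0 //; lra.
Qed.

Lemma expR_3div2_le : expR (3 / 2) <= 449 / 100 :> R.
Proof.
have h : expR (1 / 16) <= 33 / 31 :> R.
  by have := @expR_pade_le (1 / 16) ltac:(lra); lra.
have -> : 3 / 2 = (1 / 16) * 24%:R :> R by lra.
rewrite expRM_natr; apply: (@le_trans _ _ ((33 / 31) ^+ 24)); last by lra.
by rewrite lerXn2r // ?nnegrE ?expR_ge0 //; lra.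
Qed.

Lemma ln4_le : ln 4 <= 1389 / 1000 :> R.
Proof.
rewrite -(expRK (1389 / 1000)) ler_ln ?posrE ?expR_gt0 //.
have -> : 1389 / 1000 = (1389 / 2000) * 2%:R :> R by lra.
rewrite expRM_natr; apply: (@le_trans _ _ ((2001 / 1000) ^+ 2)); first by lra.
rewrite lerXn2r // ?nnegrE ?expR_ge0 //; first by lra.
apply: le_trans (@expR_ge_partial_sum _ 5 _); last by lra.
rewrite /series /= !big_nat_recr//= big_geq // /exp_coeff /= !factS fact0; lra.
Qed.

(** The Padé bound at z = ln (y / x); equivalently, the logarithmic mean is at most the arithmetic
    mean. *)
Lemma ln_sub_ge x y : 0 < x -> x <= y -> 2 * (y - x) <= (ln y - ln x) * (x + y).
Proof.
move=> x0 xy; have y0 := lt_le_trans x0 xy.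
have := @expR_pade_le (ln y - ln x).
rewrite subr_ge0 ler_ln ?posrE // => /(_ xy).
rewrite expRB !lnK ?posrE // mulrAC ler_pdivrMr //.
move: (ln y - ln x) => l h; nra.
Qed.

(** For u in [x, y], 2(1 - u) = u * 2(1/u - 1) <= y * 2(1/u - 1); both sides of the claim are
    integrals of these over [x, y]. *)
Lemma layer_cake_step x y : 0 < x -> x <= y -> y <= 1 ->
  (1 - x) ^+ 2 - (1 - y) ^+ 2 <= y * (2 * (ln y - y - (ln x - x))).
Proof.
move=> x0 xy y1; have := ln_sub_ge x0 xy; set l := ln y - ln x => hl.
have -> : ln y - y - (ln x - x) = l - (y - x) by rewrite /l; ring.
have xy0 : 0 < x + y by lra.
have : 2 * (y - x) / (x + y) <= l by rewrite ler_pdivrMr.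
have e : (y - x) * (2 + y - x) <= 2 * y * (2 * (y - x) / (x + y)).
  rewrite mulrA ler_pdivlMr //; rewrite -subr_ge0.
  have -> : 2 * y * (2 * (y - x)) - (y - x) * (2 + y - x) * (x + y) = (y - x) ^+ 2 * (2 - x - y) by ring.
  by rewrite mulr_ge0 ?sqr_ge0 //; lra.
move=> hl2; have := ler_wpM2l (_ : 0 <= 2 * y) hl2; have -> : 0 <= 2 * y by lra.
by move=> /(_ isT) h; have := le_trans e h; lra.
Qed.

(** Let F(t) be the sum of the f i with t <= y i. The left side is the integral of 2(1 - t) F(t)
    over [x, 1], and F(t) <= q / t by hypothesis. The induction moves x up to the next value of y,
    an interval on which F is constant. *)
Lemma layer_cake (I : finType) (f y : I -> R) (q x : R) :
  (forall i, 0 <= f i) -> (forall i, y i <= 1) ->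
  (forall t, 0 < t <= 1 -> t * \sum_(i | t <= y i) f i <= q) ->
  0 < x <= 1 ->
  \sum_(i | x < y i) f i * ((1 - x) ^+ 2 - (1 - y i) ^+ 2)
    <= q * (2 * (x - 1 - ln x)).
Proof.
move=> f0 y1 tail; have [n] := ubnP #|[pred i | x < y i]|.
have q0 : 0 <= q.
  apply: le_trans (tail 1 _); last by rewrite ltr01 lexx.
  by rewrite mul1r sumr_ge0.
elim: n x => // n IHn x; rewrite ltnS => le_n /andP[x0 x1].
case: (pickP [pred i | x < y i]) => [i1 /= xi1|none]; last first.
  rewrite big_pred0 //; apply: mulr_ge0 => //; apply: mulr_ge0 => //.
  by have := ln_sub_ge x0 x1; rewrite ln1; nra.
case: (@arg_minP _ _ _ i1 [pred i | x < y i] y xi1) => i0 /= xi0 min_i0.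
have ltE i : (x < y i) = (y i0 <= y i).
  by apply/idP/idP => [/min_i0 //|]; apply: lt_le_trans.
have yi0 : 0 < y i0 by apply: lt_trans xi0.
rewrite (eq_bigl _ _ ltE).
have -> : \sum_(i | y i0 <= y i) f i * ((1 - x) ^+ 2 - (1 - y i) ^+ 2) =
  ((1 - x) ^+ 2 - (1 - y i0) ^+ 2) * (\sum_(i | y i0 <= y i) f i) +
  \sum_(i | y i0 < y i) f i * ((1 - y i0) ^+ 2 - (1 - y i) ^+ 2).
  have -> : \sum_(i | y i0 < y i) f i * ((1 - y i0) ^+ 2 - (1 - y i) ^+ 2) =
      \sum_(i | y i0 <= y i) f i * ((1 - y i0) ^+ 2 - (1 - y i) ^+ 2).
    rewrite big_mkcond [RHS]big_mkcond; apply: eq_bigr => i _.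
    by case: ltgtP => // <-; rewrite subrr mulr0.
  by rewrite mulr_sumr -big_split; apply: eq_bigr => i _ /=; ring.
have rest : \sum_(i | y i0 < y i) f i * ((1 - y i0) ^+ 2 - (1 - y i) ^+ 2) <=
    q * (2 * (y i0 - 1 - ln (y i0))).
  apply: IHn; last by rewrite yi0 y1.
  apply: leq_trans le_n; apply: proper_card; apply/properP; split.
    by apply/fintype.subsetP => i; rewrite !inE; apply: lt_trans.
  by exists i0; rewrite !inE ?ltxx.
have := layer_cake_step x0 (ltW xi0) (y1 i0).
have := tail (y i0); rewrite yi0 y1 => /(_ isT).
set s := \sum_(i | _) f i; set d := _ - (1 - y i0) ^+ 2 => ts hd.
have s0 : 0 <= s by apply: sumr_ge0.
set g := 2 * (ln (y i0) - y i0 - (ln x - x)) in hd.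
have : d * s <= y i0 * g * s by apply: ler_wpM2r.
have g0 : 0 <= g.
  by rewrite -(pmulr_rge0 _ yi0); apply: le_trans hd; rewrite /d; have := y1 i0; nra.
have : g * (y i0 * s) <= g * q by apply: ler_wpM2l.
by move: rest; rewrite /g; lra.
Qed.
Lemma moebius_mul (t e f : R) : 0 <= t -> t < e * f -> 0 < e <= 1 -> 0 < f <= 1 ->
  (e * f - t) / (1 - t * (e * f)) <= (e - t) / (1 - t * e) * ((f - t) / (1 - t * f)).
Proof.
move=> t0 tef /andP[e0 e1] /andP[f0 f1].
have te : t < e by nra.
have tf : t < f by nra.
have t1 : t < 1 by lra.
have d1 : 0 < 1 - t * e by nra.
have d2 : 0 < 1 - t * f by nra.
have ef1 : e * f <= 1 by nra.
have d3 : 0 < 1 - t * (e * f) by nra.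
rewrite mulf_div ler_pdivrMr // mulrAC ler_pdivlMr ?mulr_gt0 // -subr_ge0.
have -> : (e - t) * (f - t) * (1 - t * (e * f)) - (e * f - t) * ((1 - t * e) * (1 - t * f)) =
  t * (1 + t) * (1 - e * f) * ((1 - e) * (1 - f)) by ring.
by rewrite !mulr_ge0 //; lra.
Qed.

Lemma moebius_prod (I : finType) (P : pred I) (e : I -> R) (t : R) :
  (forall i, P i -> 0 < e i <= 1) -> 0 <= t < \prod_(i | P i) e i ->
  (\prod_(i | P i) e i - t) / (1 - t * \prod_(i | P i) e i) <=
    \prod_(i | P i) ((e i - t) / (1 - t * e i)).
Proof.
(* [Q] keeps t < x as a premise: it passes from a product to its subproducts because the factors are
   at most 1. *)
move=> e01 t_lt; pose Q (x y : R) := 0 < x <= 1 /\ (0 <= t < x -> (x - t) / (1 - t * x) <= y).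
have h : Q (\prod_(i | P i) e i) (\prod_(i | P i) ((e i - t) / (1 - t * e i))); last first.
  by case: h => _; apply.
rewrite {t_lt}.
elim/big_rec2: _ => [|i y x Pi [x01 IH]].
  by split; [rewrite ltr01 lexx|move=> /andP[_ t1]; rewrite mulr1 divff // subr_eq0 gt_eqF].
have /andP[ei0 ei1] := e01 i Pi; have /andP[x0 x1] := x01; split.
  by rewrite mulr_gt0 //= mulr_ile1 // ltW.
move=> /andP[t0 tx]; apply: le_trans (moebius_mul t0 tx (e01 i Pi) x01) _.
have tx' : t < x by nra.
apply: ler_wpM2l; first by apply: divr_ge0; nra.
by apply: IH; rewrite t0.
Qed.
End RealInequalities.

(** * Expectation over live-edge graphs *)

Section ProductMeasure.
Variables (R : realType) (V : finType) (E : rel V) (p : V -> V -> R).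
Implicit Types (phi psi A B : {set V * V}) (f g : {set V * V} -> R).

Definition mean f : R := \sum_(phi in realizations E) prob E p phi * f phi.

(** The finite form of measurability with respect to the edges in [A]. *)
Definition supported A f :=
  {in realizations E &, forall phi psi, phi :&: A = psi :&: A -> f phi = f psi}.

Lemma realizationsE phi : (phi \in realizations E) = (phi \subset edge_set E).
Proof. by rewrite inE. Qed.

Lemma sum_realizations_prod (a b : V * V -> R) :
  \sum_(phi in realizations E) \prod_(e in edge_set E) (if e \in phi then a e else b e) =
  \prod_(e in edge_set E) (a e + b e).
Proof.
(* The defaults 0 and 1 off [E] kill every edge set that leaves [E] and are neutral for the
   others. *)
pose a' e := if e \in edge_set E then a e else 0.
pose b' e := if e \in edge_set E then b e else 1.
rewrite [RHS](_ : _ = \prod_e (a' e + b' e)); last first.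
  rewrite big_mkcond; apply: eq_bigr => e _; rewrite /a' /b'.
  by case: ifP; rewrite ?add0r.
rewrite bigA_distr [RHS](bigID (fun phi => phi \in realizations E)) /=.
rewrite [X in _ = _ + X]big1 ?addr0; last first.
  move=> phi; rewrite realizationsE => /subsetPn[e ephi eE].
  by rewrite (bigD1 e) //= ephi /a' (negPf eE) mul0r.
apply: eq_bigr => phi; rewrite realizationsE => /fintype.subsetP phiE.
rewrite [LHS]big_mkcond; apply: eq_bigr => e _; rewrite /a' /b'.
by case: (boolP (e \in edge_set E)) => [//|/(contra (phiE e))/negPf ->].
Qed.

Lemma prob_total : \sum_(phi in realizations E) prob E p phi = 1.
Proof.
rewrite (sum_realizations_prod (fun e => p e.1 e.2) (fun e => 1 - p e.1 e.2)).
by rewrite big1 // => e _; rewrite addrC subrK.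
Qed.

Lemma mean_cst c : mean (fun=> c) = c.
Proof. by rewrite /mean -mulr_suml prob_total mul1r. Qed.

Lemma meanD f g : mean (fun phi => f phi + g phi) = mean f + mean g.
Proof. by rewrite /mean -big_split; apply: eq_bigr => phi _ /=; rewrite mulrDr. Qed.

Lemma meanZ c f : mean (fun phi => c * f phi) = c * mean f.
Proof. by rewrite /mean mulr_sumr; apply: eq_bigr => phi _; rewrite mulrCA. Qed.

Lemma mean1B f : mean (fun phi => 1 - f phi) = 1 - mean f.
Proof.
have := meanD (fun=> 1) (fun phi => (-1) * f phi).
by rewrite meanZ mean_cst mulN1r => <-; apply: eq_bigr => phi _; rewrite mulN1r.
Qed.

Lemma mean_sum (I : finType) (P : pred I) (F : I -> {set V * V} -> R) :
  mean (fun phi => \sum_(i | P i) F i phi) = \sum_(i | P i) mean (F i).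
Proof. by rewrite /mean exchange_big; apply: eq_bigr => phi _; rewrite mulr_sumr. Qed.

Lemma eq_mean f g : {in realizations E, f =1 g} -> mean f = mean g.
Proof. by move=> fg; apply: eq_bigr => phi /fg ->. Qed.

Definition mix A phi psi := (phi :&: A) :|: (psi :\: A).

Lemma mix_realizations A phi psi : phi \in realizations E -> psi \in realizations E ->
  mix A phi psi \in realizations E.
Proof.
rewrite !realizationsE => phiE psiE; rewrite finset.subUset.
by rewrite (fintype.subset_trans (finset.subsetIl _ _)) // (fintype.subset_trans (finset.subsetDl _ _)).
Qed.

Lemma prob_mix A phi psi :
  prob E p (mix A phi psi) * prob E p (mix A psi phi) = prob E p phi * prob E p psi.
Proof.
rewrite /prob -!big_split; apply: eq_bigr => e _ /=; rewrite !inE.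
by case: (e \in A); rewrite ?andbT ?andbF ?orbF //= mulrC.
Qed.

Lemma mean_mul_supported A f g : supported A f -> supported (~: A) g ->
  mean (fun phi => f phi * g phi) = mean f * mean g.
Proof.
(* The total mass 1 supplies a second, independent realization. *)
move=> fA gA; rewrite -[LHS]mulr1 -prob_total /mean !mulr_suml.
under eq_bigr do rewrite mulr_sumr.
under [RHS]eq_bigr do rewrite mulr_sumr.
rewrite !pair_big_dep /=.
(* Exchanging two independent copies outside [A] preserves their joint law. *)
pose h (x : {set V * V} * {set V * V}) := (mix A x.1 x.2, mix A x.2 x.1).
have mixK phi psi : mix A (mix A phi psi) (mix A psi phi) = phi.
  by apply/setP => e; rewrite !inE; case: (e \in A); rewrite ?andbT ?andbF ?orbF.
have hK : involutive h by case=> phi psi; rewrite /h /= !mixK.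
rewrite (reindex_inj (inv_inj hK)) /=; apply: eq_big => [[phi psi]|[phi psi]] /=.
  apply/andP/andP => -[h1 h2]; split; try exact: mix_realizations.
    by rewrite -(mixK phi psi) mix_realizations.
  by rewrite -(mixK psi phi) mix_realizations.
case/andP=> h1 h2; have phiE : phi \in realizations E by rewrite -(mixK phi psi) mix_realizations.
have psiE : psi \in realizations E by rewrite -(mixK psi phi) mix_realizations.
have -> : f (mix A phi psi) = f phi.
  by apply: fA => //; apply/setP => e; rewrite !inE; case: (e \in A); rewrite ?andbT ?andbF ?orbF.
have -> : g (mix A phi psi) = g psi.
  by apply: gA => //; apply/setP => e; rewrite !inE; case: (e \in A); rewrite ?andbT ?andbF ?orbF.
rewrite mulrAC prob_mix; ring.
Qed.

Lemma supportedS A B f : A \subset B -> supported A f -> supported B f.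
Proof.
move=> AB fA phi psi phiE psiE eqB; apply: fA => //.
by rewrite -(finset.setIidPr AB) !finset.setIA eqB.
Qed.

Lemma supportedM A f g : supported A f -> supported A g ->
  supported A (fun phi => f phi * g phi).
Proof. by move=> fA gA phi psi h h' e; rewrite (fA _ _ h h' e) (gA _ _ h h' e). Qed.

Lemma supported1B A f : supported A f -> supported A (fun phi => 1 - f phi).
Proof. by move=> fA phi psi h h' e; rewrite (fA _ _ h h' e). Qed.

Lemma supported_live A e : e \in A -> supported A (fun phi => (e \in phi)%:R).
Proof.
by move=> eA phi psi _ _ /setP/(_ e); rewrite !inE eA !andbT => ->.
Qed.

Lemma mean_mul_disjoint A B f g : [disjoint A & B] -> supported A f -> supported B g ->
  mean (fun phi => f phi * g phi) = mean f * mean g.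
Proof.
move=> dAB fA gB; apply: (mean_mul_supported fA); apply: supportedS gB.
by rewrite -finset.disjoints_subset disjoint_sym.
Qed.

Lemma mean_prod (I : finType) (P : pred I) (A : I -> {set V * V}) (F : I -> {set V * V} -> R) :
  (forall i, P i -> supported (A i) (F i)) ->
  (forall i j, P i -> P j -> i != j -> [disjoint A i & A j]) ->
  mean (fun phi => \prod_(i | P i) F i phi) = \prod_(i | P i) mean (F i).
Proof.
move=> FA dA.
suff H (s : seq I) : uniq s -> mean (fun phi => \prod_(i <- s | P i) F i phi) =
    \prod_(i <- s | P i) mean (F i) by apply: H; rewrite index_enum_uniq.
elim: s => [_|i s IHs /= /andP[is_ us]].
  by rewrite big_nil -[RHS](mean_cst 1); apply: eq_mean => phi _; rewrite big_nil.
rewrite big_cons -IHs //; under eq_mean do rewrite big_cons.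
case: ifP => // Pi; apply: (mean_mul_supported (FA i Pi)).
move=> phi psi phiE psiE e; rewrite big_seq_cond [RHS]big_seq_cond; apply: eq_bigr => j /andP[js Pj].
apply: (FA j Pj) => //; have : A j \subset ~: A i.
  rewrite -finset.disjoints_subset; apply: dA => //.
  by apply: contraNneq is_ => <-.
by move/finset.setIidPr <-; rewrite !finset.setIA e.
Qed.

Lemma mean_live e : e \in edge_set E -> mean (fun phi => (e \in phi)%:R) = p e.1 e.2.
Proof.
(* Giving [e] the blocked weight 0 keeps exactly the realizations that contain [e]. *)
move=> eE; pose b x := if x == e then 0 else 1 - p x.1 x.2.
transitivity (\prod_(x in edge_set E) (p x.1 x.2 + b x)); last first.
  rewrite (bigD1 e) //= /b eqxx addr0 big1 ?mulr1 // => x /andP[_ /negPf ->].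
  by rewrite addrC subrK.
rewrite -(sum_realizations_prod (fun x => p x.1 x.2)); apply: eq_bigr => phi _.
rewrite /prob (bigD1 e) //= [RHS](bigD1 e) //= /b eqxx.
case: ifP => _; rewrite ?mulr1 ?mulr0 ?mul0r //; congr (_ * _).
by apply: eq_bigr => x /andP[_ /negPf ->].
Qed.

Hypothesis p01 : forall u v, E u v -> 0 <= p u v <= 1.

Lemma prob_ge0 phi : 0 <= prob E p phi.
Proof.
apply: prodr_ge0 => e; rewrite inE => /p01 /andP[p0 p1].
by case: ifP => // _; rewrite subr_ge0.
Qed.

Lemma le_mean f g : {in realizations E, forall phi, f phi <= g phi} -> mean f <= mean g.
Proof. by move=> fg; apply: ler_sum => phi /fg; apply: ler_wpM2l; apply: prob_ge0. Qed.

Lemma mean_ge0 f : {in realizations E, forall phi, 0 <= f phi} -> 0 <= mean f.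
Proof. by move=> f0; apply: sumr_ge0 => phi /f0; apply: mulr_ge0; apply: prob_ge0. Qed.
End ProductMeasure.

(** * Reachability in in-forests *)

Section InForest.
Variables (R : realType) (V : finType) (E : rel V) (p : V -> V -> R).
Hypothesis p01 : forall u v, E u v -> 0 <= p u v <= 1.
Hypothesis E_fun : forall x y z, E x y -> E x z -> y = z.
Hypothesis E_acyclic : forall x y, E x y -> ~~ connect E y x.
Implicit Types (phi psi : {set V * V}) (S H L : {set V}).

Lemma connect_step (e : rel V) x y :
  connect e x y -> x = y \/ exists2 z, e x z & connect e z y.
Proof.
case/connectP => -[|z q] /=; first by move=> _ ->; left.
by case/andP => xz pq ->; right; exists z => //; apply/connectP; exists q.
Qed.

Lemma connect_rstep (e : rel V) x y :
  connect e x y -> x = y \/ exists2 z, connect e x z & e z y.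
Proof.
case/connectP => q; case/lastP: q => [|q z] /=; first by move=> _ ->; left.
rewrite rcons_path last_rcons => /andP[pq lz] ->; right.
by exists (last x q) => //; apply/connectP; exists q.
Qed.

(** Out-degree at most one makes the nodes reachable from [x] a chain. *)
Lemma connect_total x y z : connect E x y -> connect E x z ->
  connect E y z || connect E z y.
Proof.
case/connectP => q; elim: q x => [|w q IHq] x /=; first by move=> _ -> ->.
case/andP => xw pq lq /connect_step[<-|[w' xw' w'z]].
  by apply/orP; right; apply: connect_trans (connect1 xw) _; apply/connectP; exists q.
by apply: (IHq w) => //; rewrite (E_fun xw xw').
Qed.

(** Both nodes lie on the chain from [x]. If [c] came strictly before [c'], its only out-edge would
    lead through [u] to [c'] and close a cycle. *)
Lemma sibling_disjoint u c c' x : E c u -> E c' u -> connect E x c -> connect E x c' -> c = c'.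
Proof.
have wlog_case a a' : E a u -> E a' u -> connect E a a' -> a = a'.
  move=> au a'u /connect_step[//|[w aw]].
  by rewrite -(E_fun au aw) => ua'; have := E_acyclic a'u; rewrite ua'.
move=> cu c'u xc /(connect_total xc) /orP[|] h; first exact: wlog_case.
by apply/esym; exact: wlog_case.
Qed.

Lemma realizations_live phi x y : phi \in realizations E -> (x, y) \in phi -> E x y.
Proof. by rewrite realizationsE => /fintype.subsetP h /h; rewrite inE. Qed.

Definition live phi : rel V := fun x y => (x, y) \in phi.

Lemma connect_live phi x y : phi \in realizations E -> connect (live phi) x y -> connect E x y.
Proof.
move=> phiE; have sub : subrel (live phi) (connect E).
  by move=> a b ab; apply: connect1; apply: realizations_live ab.
exact: connect_sub sub x y.
Qed.

Lemma reachP phi S u : reflect (exists2 s, s \in S & connect (live phi) s u) (u \in reach phi S).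
Proof. by rewrite inE; exact: exists_inP. Qed.

Lemma reach_step phi S u : (u \in reach phi S) =
  (u \in S) || [exists c, ((c, u) \in phi) && (c \in reach phi S)].
Proof.
apply/reachP/orP => [[s sS /connect_rstep[<-|[c sc cu]]]|[uS|/existsP[c /andP[cu /reachP[s sS sc]]]]].
- by left.
- by right; apply/existsP; exists c; apply/andP; split => //; apply/reachP; exists s.
- by exists u.
- by exists s => //; apply: connect_trans sc (connect1 cu).
Qed.

(** The only edges whose status can affect whether [u] is reached. *)
Definition upstream u : {set V * V} := [set e in edge_set E | connect E e.2 u].

Lemma connect_upstream phi psi x u : phi \in realizations E ->
  phi :&: upstream u = psi :&: upstream u -> connect (live phi) x u -> connect (live psi) x u.
Proof.
move=> phiE eq_up /connectP[q]; elim: q x => [|w q IHq] x /=; first by move=> _ ->.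
case/andP => xw pq lq; apply: connect_trans (IHq w pq lq); apply: connect1.
have wu : connect E w u by apply: (connect_live phiE); apply/connectP; exists q.
have /setP/(_ (x, w)) := eq_up; rewrite !inE /= wu (realizations_live phiE xw) !andbT.
by rewrite /live => <-.
Qed.

Lemma reach_upstream phi psi S u : phi \in realizations E -> psi \in realizations E ->
  phi :&: upstream u = psi :&: upstream u -> (u \in reach phi S) = (u \in reach psi S).
Proof.
move=> phiE psiE e; apply/reachP/reachP => -[s sS su]; exists s => //.
  exact: connect_upstream e su.
exact: connect_upstream (esym e) su.
Qed.

Lemma supported_reach S u : supported E (upstream u) (fun phi => (u \in reach phi S)%:R : R).
Proof. by move=> phi psi phiE psiE e; rewrite (reach_upstream S phiE psiE e). Qed.

Definition branch u c : {set V * V} := (c, u) |: upstream c.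

(** An in-neighbour influences [u] through its own branch only, so disjointness makes these
    influences independent. *)
Lemma branch_disjoint u c c' : E c u -> E c' u -> c != c' ->
  [disjoint branch u c & branch u c'].
Proof.
move=> cu c'u /eqP cc'; rewrite -finset.setI_eq0; apply/eqP/setP => -[a b]; rewrite !inE /=.
apply/negbTE/negP => /andP[/orP[/eqP e|/andP[ab bc]] /orP[/eqP e'|/andP[ab' bc']]].
- by apply: cc'; have := congr1 fst (etrans (esym e) e').
- by have := E_acyclic c'u; rewrite (_ : u = b) ?bc' //; case: e.
- by have := E_acyclic cu; rewrite (_ : u = b) ?bc //; case: e'.
- exact: cc' (sibling_disjoint cu c'u bc bc').
Qed.

Lemma miss_prod phi S u : phi \in realizations E ->
  1 - (u \in reach phi S)%:R = (u \notin S)%:R *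
    \prod_(c | E c u) (1 - ((c, u) \in phi)%:R * (c \in reach phi S)%:R) :> R.
Proof.
move=> phiE; rewrite reach_step; case: (boolP (u \in S)) => uS /=.
  by rewrite subrr mul0r.
rewrite mul1r; case: existsP => [[c /andP[cu cS]]|none].
  rewrite (bigD1 c) /=; last exact: realizations_live cu.
  by rewrite cu cS mulr1 subrr mul0r.
rewrite subr0 big1 // => c _; case: (boolP ((c, u) \in phi)) => cu; last by rewrite mul0r subr0.
case: (boolP (c \in _)) => cS; last by rewrite mulr0 subr0.
by case: none; exists c; rewrite cu.
Qed.

(** * Reach probabilities and their recursion along the tree *)

Definition hit S u : R := mean E p (fun phi => (u \in reach phi S)%:R).

Lemma supported_branch S u c : E c u ->
  supported E (branch u c) (fun phi => 1 - ((c, u) \in phi)%:R * (c \in reach phi S)%:R : R).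
Proof.
move=> cu; apply: supported1B; apply: supportedM.
  by apply: supported_live; rewrite !inE eqxx.
by apply: supportedS (@supported_reach S c); apply: finset.subsetUr.
Qed.

Lemma mean_branch S u c : E c u ->
  mean E p (fun phi => 1 - ((c, u) \in phi)%:R * (c \in reach phi S)%:R) = 1 - p c u * hit S c.
Proof.
move=> cu; rewrite mean1B; congr (1 - _).
rewrite (@mean_mul_disjoint _ _ _ _ [set (c, u)] (upstream c)).
- by rewrite mean_live // inE.
- rewrite -finset.setI_eq0; apply/eqP/setP => -[a b]; rewrite !inE /=.
  apply/negbTE/negP => /andP[/eqP[-> ->] /andP[_ uc]].
  by have := E_acyclic cu; rewrite uc.
- by apply: supported_live; rewrite inE.
- exact: supported_reach.
Qed.

Lemma hit_rec S u : 1 - hit S u = (u \notin S)%:R * \prod_(c | E c u) (1 - p c u * hit S c).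
Proof.
rewrite -mean1B (eq_mean _ (fun phi => @miss_prod phi S u)) meanZ; congr (_ * _).
rewrite (@mean_prod _ _ _ _ _ _ (branch u)).
- by apply: eq_bigr => c cu; apply: mean_branch.
- by move=> c cu; apply: supported_branch.
- by move=> c c' cu c'u; apply: branch_disjoint.
Qed.

Lemma hit_ge0 S u : 0 <= hit S u.
Proof. exact: mean_ge0. Qed.

Lemma hit_le1 S u : hit S u <= 1.
Proof.
rewrite -[leRHS](mean_cst E p); apply: le_mean => // phi _; by rewrite lern1 leq_b1.
Qed.

(* The tree path from [v] to [u]; it is empty unless [v] is upstream of [u]. *)
Definition tree_path v u : {set V * V} :=
  [set e in edge_set E | connect E v e.1 && connect E e.2 u].

Lemma tree_path_realizations phi v u : phi \in realizations E ->
  phi :|: tree_path v u \in realizations E.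
Proof.
rewrite !realizationsE finset.subUset => ->.
by apply/fintype.subsetP => e; rewrite inE => /andP[].
Qed.

Definition miss S u v : R :=
  mean E p (fun phi => 1 - (u \in reach (phi :|: tree_path v u) S)%:R).

Lemma miss_root S u : miss S u u = 1 - hit S u.
Proof.
rewrite -mean1B; apply: eq_mean => phi _; suff -> : tree_path u u = finset.set0 by rewrite finset.setU0.
apply/setP => -[a b]; rewrite !inE /=; apply/negbTE/negP => /andP[ab /andP[ua bu]].
by have := E_acyclic ab; rewrite (connect_trans bu ua).
Qed.

(** Once the path from [v] to [u] is forced, the edge (c, u) is certain, which removes the factor
    [p c u]; branch [c] sees the path from [v] to [c] forced, and the other branches do not meet the
    path. *)
Lemma miss_rec S u c v : E c u -> connect E v c ->
  miss S u v = (u \notin S)%:R * (miss S c v * \prod_(d | E d u && (d != c)) (1 - p d u * hit S d)).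
Proof.
move=> cu vc.
pose F d phi : R := if d == c then 1 - (c \in reach (phi :|: tree_path v c) S)%:R
  else 1 - ((d, u) \in phi)%:R * (d \in reach phi S)%:R.
have cu' := connect1 cu.
have pw : {in realizations E, forall phi, 1 - (u \in reach (phi :|: tree_path v u) S)%:R =
    (u \notin S)%:R * \prod_(d | E d u) F d phi}.
  move=> phi phiE; have phiE' := @tree_path_realizations phi v u phiE.
  rewrite miss_prod //; congr (_ * _); apply: eq_bigr => d du; rewrite /F.
  case: eqP => [->|/eqP dc].
    have -> : (c, u) \in phi :|: tree_path v u by rewrite !inE /= cu vc connect0 orbT.
    rewrite mul1r; congr (1 - (_ : bool)%:R).
    apply: reach_upstream => //; first exact: tree_path_realizations.
    apply/setP => -[a b]; rewrite !inE /=; case: (boolP (connect E b c)) => bc; rewrite ?andbF //.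
    by rewrite (connect_trans bc cu').
  have nvd : ~~ connect E v d by apply: contra dc => vd; apply/eqP; exact: sibling_disjoint du cu vd vc.
  have -> : ((d, u) \in phi :|: tree_path v u) = ((d, u) \in phi).
    by rewrite !inE /= (negPf nvd) andbF orbF.
  congr (1 - _ * (_ : bool)%:R).
  apply: reach_upstream => //; apply/setP => -[a b]; rewrite !inE /=.
  case: (boolP (connect E b d)) => bd; rewrite ?andbF //=.
  case: (boolP (E a b)) => ab; rewrite ?orbF // andbT.
  case: (boolP (connect E v a)) => va; rewrite ?orbF //.
  by move: nvd; rewrite (connect_trans va (connect_trans (connect1 ab) bd)).
rewrite /miss (eq_mean _ pw) meanZ; congr (_ * _).
rewrite (@mean_prod _ _ _ _ _ _ (branch u)).
- rewrite (bigD1 c) //= /F eqxx; congr (_ * _).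
  apply: eq_bigr => d /andP[du /negPf ->]; exact: mean_branch.
- move=> d du; rewrite /F; case: eqP => [->|_]; last exact: supported_branch.
  apply: (@supportedS _ _ _ (upstream c)); first exact: finset.subsetUr.
  apply: supported1B => phi psi phiE psiE e; congr ((_ : bool)%:R).
  apply: reach_upstream; try exact: tree_path_realizations.
  by rewrite !finset.setIUl e.
- by move=> d d' du d'u; apply: branch_disjoint.
Qed.

Lemma upset_proper c u : E c u ->
  (#|[set x | connect E x c]| < #|[set x | connect E x u]|)%N.
Proof.
move=> cu; apply: proper_card; apply/properP; split.
  by apply/fintype.subsetP => x; rewrite !inE => xc; apply: connect_trans xc (connect1 cu).
by exists u; rewrite !inE ?connect0 // E_acyclic.
Qed.

(** This controls what all of [H] can do by what each of its nodes could still gain alone. The bound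
    is s^2 rather than s because the square roots of the branch factors enter [moebius_prod]. *)
Lemma hit_ge S H u s : 0 <= s <= 1 ->
  (forall v, v \in H -> connect E v u -> miss S u v <= s ^+ 2) ->
  (1 - s) * hit H u <= hit S u.
Proof.
have [n] := ubnP #|[set x | connect E x u]|.
elim: n u s => // n IHn u s; rewrite ltnS => le_n /andP[s0 s1] missH.
have hitS := hit_rec S u; have hitH := hit_rec H u.
have hH0 := hit_ge0 H u; have hH1 := hit_le1 H u.
have [uS|uS] := boolP (u \in S).
  by move: hitS; rewrite uS mul0r => /eqP; rewrite subr_eq0 => /eqP <-; nra.
move: hitS; rewrite uS mul1r; set D := \prod_(c | E c u) _ => hitS.
have [uH|uH] := boolP (u \in H).
  have := missH u uH (connect0 _ _); rewrite miss_root; nra.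
(* [D] is the probability that [S] misses [u], so D <= s settles the claim; s < D yields t < e0
   below. *)
have [Ds|sD] := leP D s; first by nra.
have d01 c : E c u -> 0 <= 1 - p c u * hit S c <= 1.
  move=> cu; have /andP[p0 p1] := p01 cu; have := hit_ge0 S c; have := hit_le1 S c.
  by nra.
have D0 : 0 < D by lra.
have d_gt0 c : E c u -> 0 < 1 - p c u * hit S c.
  move=> cu; have /andP[d0 _] := d01 c cu; rewrite lt_neqAle d0 andbT.
  by apply: contraTneq D0 => d_eq; rewrite /D (bigD1 c) //= -d_eq mul0r ltxx.
pose e c := Num.sqrt (1 - p c u * hit S c).
have eE c : E c u -> e c ^+ 2 = 1 - p c u * hit S c.
  by move=> cu; rewrite sqr_sqrtr // ltW ?d_gt0.
have e01 c : E c u -> 0 < e c <= 1.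
  move=> cu; have /andP[_ d1] := d01 c cu; rewrite sqrtr_gt0 d_gt0 //=.
  by rewrite -sqrtr1 ler_wsqrtr.
set e0 := \prod_(c | E c u) e c.
have e0E : e0 ^+ 2 = D by rewrite -prodrXl; apply: eq_bigr => c cu; apply: eE.
have e0_gt0 : 0 < e0 by apply: prodr_gt0 => c cu; case/andP: (e01 c cu).
have e0_le c : E c u -> e0 <= e c.
  move=> cu; rewrite /e0 (bigD1 c) //= ler_piMr //; first by case/andP: (e01 c cu) => /ltW.
  by apply: prodr_ile1 => d /andP[du _]; case/andP: (e01 d du) => /ltW -> ->.
have e0_le1 : e0 <= 1.
  by apply: prodr_ile1 => d du; case/andP: (e01 d du) => /ltW -> ->.
(* The induction hypothesis is used at the child [c] with [t * e c] for [s]. *)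
pose t := s / e0.
have t0 : 0 <= t by rewrite divr_ge0 // ltW.
have tE : t * e0 = s by rewrite /t divfK // gt_eqF.
have t_lt : t < e0 by rewrite /t ltr_pdivrMr // -expr2 e0E.
(* Since 1 - e c ^ 2 = p c u * hit S c, the induction hypothesis bounds [p c u * hit H c] by (1 - e
   c ^ 2)/(1 - t * e c), whose complement is the left side. *)
have branch_le c : E c u -> e c * ((e c - t) / (1 - t * e c)) <= 1 - p c u * hit H c.
  move=> cu; have /andP[ec0 ec1] := e01 c cu; have e0ec := e0_le c cu.
  have te1 : t * e c < 1 by nra.
  have IH : (1 - t * e c) * hit H c <= hit S c.
    apply: IHn.
    - exact: leq_trans (upset_proper cu) le_n.
    - by apply/andP; split; nra.
    move=> v vH vc; have := missH v vH (connect_trans vc (connect1 cu)).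
    rewrite (miss_rec S cu vc) uS mul1r; set Dc := \prod_(d | _) _.
    (* Dividing by Dc = e0 ^ 2 / e c ^ 2 turns s ^ 2 into (t * e c) ^ 2, whence the choice t = s /
       e0. *)
    have DE : D = e c ^+ 2 * Dc by rewrite /D (bigD1 c) //= eE.
    have Dc0 : 0 < Dc by move: D0; rewrite DE pmulr_rgt0 // exprn_gt0.
    rewrite -ler_pdivlMr // => h; apply: le_trans h _.
    rewrite ler_pdivrMr // exprMn -mulrA -DE -e0E -exprMn tE //.
  have p_ge0 : 0 <= p c u by case/andP: (p01 cu).
  have := eE c cu; have := ler_wpM2l p_ge0 IH => h1 h2.
  rewrite mulrA ler_pdivrMr ?subr_gt0 //; nra.
have t1 : 0 < 1 - t * e0 by nra.
have : e0 * ((e0 - t) / (1 - t * e0)) <= 1 - hit H u.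
  rewrite hitH uH mul1r; apply: (@le_trans _ _ (\prod_(c | E c u) (e c * ((e c - t) / (1 - t * e c))))).
    rewrite big_split /=; apply: ler_wpM2l; first exact: ltW.
    by apply: moebius_prod => //; rewrite t0.
  apply: ler_prod => c cu; rewrite branch_le // andbT.
  have /andP[ec0 ec1] := e01 c cu; have e0ec := e0_le c cu.
  by apply: mulr_ge0; [exact: ltW | apply: divr_ge0; nra].
(* With e0 ^ 2 = D and e0 * t = s the bound reads (D - s)/(1 - s) <= 1 - hit H u, where D = 1 - hit
   S u. *)
rewrite mulrA ler_pdivrMr // mulrBr -expr2 e0E [e0 * t]mulrC tE; nra.
Qed.

Lemma tree_path_live phi v u : phi \in realizations E -> connect E v u ->
  connect (live phi) v u = (tree_path v u \subset phi).
Proof.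
move=> phiE vu; apply/idP/fintype.subsetP => [/connectP[q]|].
  elim: q v {vu} => [|w q IHq] v /=.
    move=> _ -> [a b]; rewrite inE /= inE => /andP[/= ab /andP[va bv]].
    by have := E_acyclic ab; rewrite (connect_trans bv va).
  case/andP=> vw pq lq [a b] /[dup] ab0; rewrite inE /= inE => /andP[/= ab /andP[va bu]].
  have vwE := realizations_live phiE vw.
  case/connect_step: va => [va|[w' vw' w'a]].
    by have <- : w = b by [apply: (E_fun vwE); rewrite va]; rewrite -va.
  by apply: (IHq w pq lq); rewrite inE /= inE /= ab bu andbT (E_fun vwE vw').
move: vu => /connectP[q]; elim: q v => [|w q IHq] v /=; first by move=> _ ->.
case/andP=> vw pq lq sub.
have wu : connect E w u by apply/connectP; exists q.
apply: connect_trans (connect1 (_ : live phi v w)) (IHq w pq lq _).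
  by apply: sub; rewrite !inE /= vw connect0.
move=> e; rewrite inE => /andP[eE /andP[we eu]]; apply: sub; rewrite inE eE eu andbT.
exact: connect_trans (connect1 vw) we.
Qed.

(** The probability that [v] reaches [u] when [v] is upstream of [u]; otherwise the path is empty
    and the value is 1. *)
Definition path_prob v u : R := mean E p (fun phi => (tree_path v u \subset phi)%:R).

(** The forced realization does not depend on the edges of the path, hence is independent of the
    path being live. *)
Lemma mean_forced v u f :
  mean E p (fun phi => (tree_path v u \subset phi)%:R * f (phi :|: tree_path v u)) =
  path_prob v u * mean E p (fun phi => f (phi :|: tree_path v u)).
Proof.
have subE phi : (tree_path v u \subset phi) = (phi :&: tree_path v u == tree_path v u).
  exact: (sameP finset.setIidPr eqP).
apply: (@mean_mul_supported _ _ _ _ (tree_path v u)) => phi psi _ _ e.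
  by rewrite !subE e.
congr f; apply/setP => x; have /setP/(_ x) := e.
rewrite !finset.in_setI !finset.in_setC !finset.in_setU.
by case: (x \in tree_path v u); rewrite ?orbT // !andbT !orbF.
Qed.

Lemma reach_setU1 phi S u v :
  (u \in reach phi (v |: S)) = connect (live phi) v u || (u \in reach phi S).
Proof.
apply/reachP/orP => [[s] |[vu|/reachP[s sS su]]].
- by rewrite finset.in_setU1 => /orP[/eqP -> |sS] su; [left | right; apply/reachP; exists s].
- by exists v; rewrite ?finset.setU11.
- by exists s; rewrite // finset.in_setU1 sS orbT.
Qed.

Lemma reach_sub phi S H : S \subset H -> reach phi S \subset reach phi H.
Proof.
move=> /fintype.subsetP SH; apply/fintype.subsetP => u /reachP[s /SH sH su].
by apply/reachP; exists s.
Qed.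

(** Adding [v] gains [u] exactly when the path is live and [S] misses [u]; on that event forcing the
    path changes nothing. *)
Lemma hit_setU1 S u v : connect E v u ->
  hit (v |: S) u - hit S u = path_prob v u * miss S u v.
Proof.
move=> vu; rewrite /miss -(@mean_forced v u (fun phi => 1 - (u \in reach phi S)%:R)).
have -> : hit (v |: S) u = mean E p (fun phi => (u \in reach phi S)%:R +
    (tree_path v u \subset phi)%:R * (1 - (u \in reach (phi :|: tree_path v u) S)%:R)).
  apply: eq_mean => phi phiE; rewrite reach_setU1 (tree_path_live phiE vu).
  case: (boolP (tree_path v u \subset phi)) => [/finset.setUidPl ->|_] /=.
    by case: (u \in _) => /=; rewrite ?subrr ?subr0 mul1r ?addr0 ?add0r.
  by rewrite mul0r addr0.
by rewrite meanD addrC addrA addNr add0r.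
Qed.

Lemma hit_setU1_ge S u v : hit S u <= hit (v |: S) u.
Proof.
apply: le_mean => // phi phiE; rewrite reach_setU1.
by case: (u \in _); rewrite ?orbT // ler0n.
Qed.

Lemma sigma_hit S : sigma E p S = \sum_u hit S u.
Proof.
rewrite -mean_sum; apply: eq_bigr => phi _; congr (_ * _).
by rewrite -sum1_card natr_sum big_mkcond; apply: eq_bigr => u _; case: ifP.
Qed.

(** * An adaptive policy compared with a fixed seed set *)

Section Policy.
Variable pi : policy V.

Definition run phi i : {set V} := iter i (policy_step pi E phi) finset.set0.

Lemma run_sub phi i j : (i <= j)%N -> run phi i \subset run phi j.
Proof.
move=> /subnKC <-; elim: (j - i)%N => [|m IHm]; first by rewrite addn0.
rewrite addnS /= /policy_step -/(run phi _).
by case: (pi _) => // v; apply: fintype.subset_trans IHm _; apply: finset.subsetUr.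
Qed.

Definition first_pick u v phi := [exists i : 'I_#|V|,
  [&& u \notin reach phi (run phi i), pi (observe E phi (run phi i)) == Some v
    & connect (live phi) v u]].

Lemma first_pick_exists u phi : u \in reach phi (policy_seeds pi E phi) ->
  exists v, first_pick u v phi.
Proof.
suff H i : (i <= #|V|)%N -> u \in reach phi (run phi i) -> exists v, first_pick u v phi by exact: H.
elim: i => [_|i IHi ltiV]; first by case/reachP => s; rewrite inE.
have [uR _|uR] := boolP (u \in reach phi (run phi i)); first exact: IHi (ltnW ltiV) uR.
rewrite /= /policy_step -/(run phi i).
case pick_v : (pi _) => [v|]; last by rewrite (negPf uR).
rewrite reach_setU1 (negPf uR) orbF => vu; exists v; apply/existsP; exists (Ordinal ltiV).
by rewrite /= uR pick_v eqxx.
Qed.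

(** Exploration from [x] inspects only edges with a reached tail, so agreement along the exploration
    in [phi] serves both directions. *)
Lemma connect_agree phi psi x u :
  (forall a b, connect (live phi) x a -> ((a, b) \in phi) = ((a, b) \in psi)) ->
  connect (live phi) x u = connect (live psi) x u.
Proof.
move=> agree; apply/idP/idP => /connectP[q]; elim: q x agree => [|w q IHq] x agree /=;
  do ?[by move=> _ ->].
  case/andP=> xw pq lq; apply: connect_trans (IHq w _ pq lq).
    by apply: connect1; rewrite /live -agree.
  by move=> a b wa; apply: agree; apply: connect_trans (connect1 xw) wa.
case/andP=> xw pq lq; have xw' : live phi x w by rewrite /live agree.
apply: connect_trans (connect1 xw') (IHq w _ pq lq).
by move=> a b wa; apply: agree; apply: connect_trans (connect1 xw') wa.
Qed.

(* Until it picks [v], the policy has observed no edge of the path from [v] to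
   [u]: an observed tail of such an edge would already reach [u]. *)
Lemma first_pick_seed u v phi psi : phi \in realizations E -> psi \in realizations E ->
  phi :\: tree_path v u = psi :\: tree_path v u -> first_pick u v phi ->
  v \in policy_seeds pi E psi.
Proof.
move=> phiE psiE agree /existsP[i /and3P[uR /eqP pick_v vu]].
have vuE := connect_live phiE vu.
have path_sub : tree_path v u \subset phi by rewrite -tree_path_live.
have edge j a b : (j <= i)%N -> a \in reach phi (run phi j) -> ((a, b) \in phi) = ((a, b) \in psi).
  move=> ji aR; have /setP/(_ (a, b)) := agree; rewrite !inE /=.
  case: (boolP [&& E a b, connect E v a & connect E b u]) => //= /and3P[ab va bu].
  case/negP: uR; have au := connect_trans (connect1 ab) bu.
  have : connect (live phi) a u.
    rewrite tree_path_live //; apply: fintype.subset_trans path_sub.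
    apply/fintype.subsetP => e; rewrite !inE => /andP[-> /andP[ae ->]].
    by rewrite (connect_trans va ae).
  move=> au'; apply: (fintype.subsetP (reach_sub phi (run_sub phi ji))).
  by case/reachP: aR => s sS sa; apply/reachP; exists s => //; apply: connect_trans sa au'.
have same_reach j : (j <= i)%N -> reach phi (run phi j) = reach psi (run phi j).
  move=> ji; apply/setP => a.
  by apply/reachP/reachP => -[s sS sa]; exists s => //; move: sa; rewrite (@connect_agree phi psi) // =>
    x y sx; apply: (edge j) => //; apply/reachP; exists s.
have same_obs j : (j <= i)%N -> observe E phi (run phi j) = observe E psi (run phi j).
  move=> ji; congr PR; apply/funext => a; apply/funext => b; rewrite -same_reach //.
  by case: (boolP (a \in _)) => //= aR; rewrite (edge j).
have same_run j : (j <= i)%N -> run psi j = run phi j.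
  elim: j => // j IHj ji; rewrite /= -!/(run _ j) /policy_step IHj ?same_obs //; exact: ltnW.
apply: (fintype.subsetP (run_sub psi (ltn_ord i))).
by rewrite /= /policy_step -/(run psi i) same_run // -same_obs // pick_v finset.setU11.
Qed.

Definition seed_prob v : R := mean E p (fun phi => (v \in policy_seeds pi E phi)%:R).

(** A first pick forces the path to be live, so it may be evaluated on the forced realization, which
    is independent of the path; there [first_pick_seed] carries the choice of [v] back to [phi]. *)
Lemma mean_first_pick u v : connect E v u ->
  mean E p (fun phi => (first_pick u v phi)%:R) <= path_prob v u * seed_prob v.
Proof.
move=> vu; apply: (@le_trans _ _ (mean E p (fun phi => (tree_path v u \subset phi)%:R *
    (first_pick u v (phi :|: tree_path v u))%:R))).
  apply: le_mean => // phi phiE; case: (boolP (first_pick u v phi)) => // fp; last first.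
    by rewrite mulr_ge0.
  have sub : tree_path v u \subset phi.
    by rewrite -tree_path_live //; case/existsP: fp => i /and3P[].
  by rewrite sub (finset.setUidPl sub) fp mulr1.
rewrite (@mean_forced v u (fun phi => (first_pick u v phi)%:R)).
apply: ler_wpM2l; first exact: mean_ge0.
apply: le_mean => // phi phiE; case: (boolP (first_pick _ _ _)) => // fp.
suff -> : v \in policy_seeds pi E phi by [].
apply: first_pick_seed fp => //; first exact: tree_path_realizations.
by rewrite finset.setDUl finset.setDv finset.setU0.
Qed.

Definition policy_hit u : R := mean E p (fun phi => (u \in reach phi (policy_seeds pi E phi))%:R).

Lemma sigma_pol_hit : sigma_pol E p pi = \sum_u policy_hit u.
Proof.
rewrite -mean_sum; apply: eq_bigr => phi _; congr (_ * _).
by rewrite -sum1_card natr_sum big_mkcond; apply: eq_bigr => u _; case: ifP.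
Qed.

(* The tail estimate is integrated over y = 1 - sqrt (miss S u v) >= 1/4, whence
   9/16 = (1 - 1/4)^2; the cutoff 1/4 is nearly optimal for the final constant. *)
Lemma policy_hit_le S u :
  9 / 16 * policy_hit u <= (2 * ln 4 - 3 / 2) * hit S u +
    \sum_(v | connect E v u) seed_prob v * (path_prob v u * miss S u v).
Proof.
(* Choosing one first pick makes the events [first phi == Some v] disjoint by construction. *)
pose first phi := [pick v | first_pick u v phi].
pose f v := mean E p (fun phi => (first phi == Some v)%:R).
have [y yE] : {y : V -> R | forall v, y v = 1 - Num.sqrt (miss S u v)} by exists (fun v => 1 - Num.sqrt (miss S u v)).
have f0 v : 0 <= f v by apply: mean_ge0.
have miss0 v : 0 <= miss S u v.
  by apply: mean_ge0 => // phi _; rewrite subr_ge0 lern1 leq_b1.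
have firstP phi v : first phi == Some v -> first_pick u v phi.
  by rewrite /first; case: pickP => // w wP /eqP[<-].
have tail t : 0 < t <= 1 -> t * \sum_(v | t <= y v) f v <= hit S u.
  move=> /andP[t0 t1]; pose H := [set v | t <= y v].
  (* At most one term is nonzero for each [phi], and a first pick in [H] means that [H] reaches [u].
     Then [hit_ge] applies with s = 1 - t. *)
  have hitH : \sum_(v | t <= y v) f v <= hit H u.
    rewrite -mean_sum; apply: le_mean => // phi phiE.
    case first_v : (first phi) => [w|]; last by rewrite big1.
    rewrite (bigID (pred1 w)) /= [X in _ + X]big1 ?addr0; last first.
      by move=> v /andP[_ vw]; rewrite (_ : (_ == _) = false) //; apply/negbTE; apply: contra vw => /eqP[->].
    case: (boolP (t <= y w)) => tw; last first.
      rewrite big1 // => v /andP[tv /eqP vw]; by rewrite -vw tv in tw.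
    rewrite (big_pred1 w) => [|v]; last first.
      by rewrite /=; case: (v =P w) => [->|_]; rewrite ?tw ?andbF.
    rewrite eqxx (_ : u \in reach phi H) //; apply/reachP; exists w; first by rewrite inE.
    by have /existsP[i /and3P[]] : first_pick u w phi by apply: firstP; rewrite first_v.
  apply: (@le_trans _ _ (t * hit H u)); first by apply: ler_wpM2l => //; exact: ltW.
  have -> : t = 1 - (1 - t) by ring.
  apply: hit_ge; first by apply/andP; split; lra.
  move=> v; rewrite inE yE => tv vu; rewrite -(sqr_sqrtr (miss0 v)).
  by rewrite lerXn2r ?nnegrE ?sqrtr_ge0 //; lra.
(* At x = 1/4 the factor 2(x - 1 - ln x) is 2 ln 4 - 3/2, and (1 - x)^2 = 9/16. *)
have := @layer_cake R V f y (hit S u) (1 / 4) f0.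
have y1 v : y v <= 1 by rewrite yE lerBlDr lerDl sqrtr_ge0.
move=> /(_ y1 tail); rewrite (_ : 0 < 1 / 4 <= 1); last by apply/andP; split; lra.
move=> /(_ isT); set s := \sum_(i | _) _ => hs.
have ln14 : ln (1 / 4) = - ln 4 :> R by rewrite mul1r lnV ?posrE.
rewrite ln14 in hs.
have total : policy_hit u <= \sum_v f v.
  rewrite -mean_sum; apply: le_mean => // phi _.
  case: (boolP (u \in _)) => [/first_pick_exists[w wP]|_]; last by rewrite sumr_ge0.
  case first_v : (first phi) => [v|]; first by rewrite (bigD1 v) //= eqxx lerDl sumr_ge0.
  by move: first_v; rewrite /first; case: pickP => // /(_ w); rewrite wP.
have f_upstream v : ~~ connect E v u -> f v = 0.
  move=> vu; rewrite /f -[RHS](mean_cst E p); apply: eq_mean => phi phiE.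
  case: (boolP (_ == _)) => // /firstP /existsP[i /and3P[_ _ /(connect_live phiE) vu']].
  by rewrite vu' in vu.
(* Where y v <= 1/4, [miss S u v] is at least 9/16, so the terms absent from [s] are nonpositive. *)
have low : \sum_v f v * (9 / 16 - miss S u v) <= s.
  rewrite /s [leLHS](bigID (fun v => 1 / 4 < y v)) /= -[leRHS]addr0; apply: lerD.
    apply: ler_sum => v _; apply: ler_wpM2l => //.
    by rewrite yE opprB addrCA subrr addr0 sqr_sqrtr //; lra.
  apply: sumr_le0 => v; rewrite -leNgt yE => yv; apply: mulr_ge0_le0 => //.
  by rewrite -(sqr_sqrtr (miss0 v)); have := sqrtr_ge0 (miss S u v); nra.
have pick_le : \sum_v f v * miss S u v <=
    \sum_(v | connect E v u) seed_prob v * (path_prob v u * miss S u v).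
  rewrite (bigID (fun v => connect E v u)) /= [X in _ + X]big1 ?addr0; last first.
    by move=> v /f_upstream ->; rewrite mul0r.
  apply: ler_sum => v vu; rewrite mulrA; apply: ler_wpM2r => //.
  rewrite mulrC; apply: le_trans (mean_first_pick vu); apply: le_mean => // phi _.
  by case: (boolP (_ == _)) => [/firstP ->|_] //; rewrite ler0n.
have split_sum : \sum_v f v * (9 / 16 - miss S u v) =
    9 / 16 * (\sum_v f v) - \sum_v f v * miss S u v.
  by rewrite mulr_sumr -sumrB; apply: eq_bigr => v _; ring.
move: low pick_le hs; rewrite split_sum; lra.
Qed.

Lemma sigma_pol_le S :
  9 / 16 * sigma_pol E p pi <= (2 * ln 4 - 3 / 2) * sigma E p S +
    \sum_v seed_prob v * (sigma E p (v |: S) - sigma E p S).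
Proof.
rewrite sigma_pol_hit sigma_hit !mulr_sumr.
apply: le_trans (ler_sum _ (fun u _ => policy_hit_le S u)) _.
rewrite big_split lerD2l /= (exchange_big_dep predT) //=.
apply: ler_sum => v _; rewrite -mulr_sumr; apply: ler_wpM2l; first exact: mean_ge0.
rewrite sigma_hit -sumrB [leRHS](bigID (fun u => connect E v u)) /= -[leLHS]addr0.
apply: lerD; last by apply: sumr_ge0 => u _; rewrite subr_ge0 hit_setU1_ge.
by apply: ler_sum => u vu; rewrite hit_setU1.
Qed.
End Policy.
End InForest.

(** * In-arborescences *)

Section Arborescence.
Variables (V : finType) (E : rel V) (r : V).
Hypothesis arb : is_in_arborescence E r.

(** Every node but [r] is the tail of some edge, and there are only |V| - 1 edges, so each is the
    tail of exactly one and [r] of none. *)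
Lemma arborescence_sources :
  {in edge_set E &, injective fst} /\ (forall x, ~~ E r x).
Proof.
case: arb => _ _ _ card_E to_r.
have sub : [set~ r] \subset [set e.1 | e in edge_set E].
  apply/fintype.subsetP => v; rewrite !inE => vr.
  case: (connect_step (to_r v)) => [vr'|[w vw _]]; first by rewrite vr' eqxx in vr.
  by apply/imsetP; exists (v, w); rewrite ?inE.
have card_r : #|[set~ r]| = #|edge_set E|.
  by rewrite cardsC1 -card_E addn1.
have card_src : #|[set e.1 | e in edge_set E]| = #|edge_set E|.
  apply/eqP; rewrite eqn_leq leq_imset_card -[in X in (X <= _)%N]card_r; exact: subset_leq_card sub.
split; first by apply/imset_injP/eqP.
move=> x; apply/negP => rx.
have /eqP eq_src : [set~ r] == [set e.1 | e in edge_set E] by rewrite eqEcard sub card_src card_r leqnn.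
have : r \in [set e.1 | e in edge_set E] by apply/imsetP; exists (r, x); rewrite ?inE.
by rewrite -eq_src !inE eqxx.
Qed.

Lemma arborescence_fun x y z : E x y -> E x z -> y = z.
Proof.
have [inj _] := arborescence_sources => xy xz.
by have := inj (x, y) (x, z); rewrite !inE => /(_ xy xz erefl) [].
Qed.

Lemma arborescence_acyclic x y : E x y -> ~~ connect E y x.
Proof.
have [_ no_out] := arborescence_sources => xy; apply/negP => yx.
(* From a node on a cycle, the unique out-edges never leave the nodes that lead back to [x]; so [r]
   would lead to [x] too. *)
have back q w : connect E w x -> path E w q -> connect E (last w q) x.
  elim: q w => [|w' q IHq] w wx //= /andP[ww' /IHq]; apply.
  case: (connect_step wx) => [wE|[w'' ww'' w''x]].
    by rewrite -(arborescence_fun xy (_ : E x w')) // -wE.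
  by rewrite (arborescence_fun ww' ww'').
have rx : connect E r x.
  have /connectP[q xq ->] : connect E x r by case: arb.
  exact: back xq.
case: (connect_step rx) => [rxE|[w rw _]]; first by move: (no_out y); rewrite rxE xy.
by move: (no_out w); rewrite rw.
Qed.
End Arborescence.

(** * Greedy seeds, the numerical constant and the adaptivity gap *)

Lemma sigma_le_OPT_N (R : realType) (V : finType) (E : rel V) (p : V -> V -> R) (k : nat) (S : {set V}) :
  (#|S| <= k)%N -> sigma E p S <= OPT_N E p k.
Proof. by move=> Sk; rewrite /OPT_N; apply: le_bigmax_cond. Qed.

(** Each step shrinks the gap B - f S by the factor 1 - c/k <= e^(-c/k), and k steps multiply to
    e^(-c). *)
Lemma greedy_seeds (R : realType) (V : finType) (f : {set V} -> R) (c B : R) (k : nat) :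
  (0 < k)%N -> 0 <= f finset.set0 -> 0 <= B -> 0 <= c ->
  (forall S, exists v, f S <= f (v |: S) /\ c * (B - f S) <= k%:R * (f (v |: S) - f S)) ->
  exists2 S : {set V}, (#|S| <= k)%N & (1 - expR (- c)) * B <= f S.
Proof.
move=> k0 f0 B0 c0 step; have k0' : 0 < k%:R :> R by rewrite ltr0n.
have greedy j : exists2 S : {set V}, (#|S| <= j)%N &
    B - f S <= expR (- (c / k%:R) * j%:R) * B.
  elim: j => [|j [S Sj le_S]].
    by exists finset.set0; rewrite ?cards0 // mulr0 expR0 mul1r; lra.
  have [v [fv gain_v]] := step S; exists (v |: S).
    by rewrite cardsU1; apply: leq_trans (leq_add (leq_b1 _) Sj) _; rewrite add1n.
  have [neg|pos] := ltP (B - f S) 0.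
    by apply: (@le_trans _ _ 0); [lra | rewrite mulr_ge0 ?expR_ge0].
  have {}gain_v : c / k%:R * (B - f S) <= f (v |: S) - f S.
    by rewrite mulrAC ler_pdivrMr // [leRHS]mulrC.
  rewrite -natr1 mulrDr mulr1 expRD -mulrA mulrCA.
  apply: (@le_trans _ _ (expR (- (c / k%:R)) * (B - f S))); last first.
    by apply: ler_wpM2l le_S; apply: expR_ge0.
  have := ler_wpM2r pos (expR_ge1Dx (- (c / k%:R))).
  lra.
have [S Sk le_S] := greedy k; exists S => //.
by move: le_S; rewrite mulNr divfK ?gt_eqF //; lra.
Qed.

(** Here e^(-c) = e^(3/2)/16 for c = 2 ln 4 - 3/2. The two sides differ by less than one percent,
    hence the sharp numerical bounds. *)
Lemma gap_constant_le (R : realType) :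
  (2 * ln 4 - 3 / 2) * (expR 1 - 1) <=
    9 / 16 * (1 - expR (- (2 * ln 4 - 3 / 2))) * (2 * expR 1) :> R.
Proof.
rewrite opprB expRB mulrC [2 * _]mulrC expRM_natr lnK ?posrE //.
have := expR1_le R; have := expR_3div2_le R; have := ln4_le R.
have := expR_ge1Dx (1 : R); have := ln_sub_ge (ltr01 : 0 < 1 :> R) (ler1n _ 4 : 1 <= 4 :> R).
rewrite ln1; set l := ln 4; set e := expR 1; set h := expR (3 / 2) => h1 h2 h3 h4 h5.
nra.
Qed.

Theorem theorem1 (R : realType) (V : finType) (E : rel V) (p : V -> V -> R)
  (r : V) (k : nat) :
  (forall u v, E u v -> 0 <= p u v <= 1) ->
  is_in_arborescence E r ->
  (1 <= k)%N ->
  OPT_A E p k / OPT_N E p k <= 2 * expR 1 / (expR 1 - 1).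
Proof.
move=> p01 arb k1.
have E_fun := arborescence_fun arb; have E_acyclic := arborescence_acyclic arb.
have e1 : 1 < expR 1 :> R by rewrite expR_gt1.
pose c : R := 2 * ln 4 - 3 / 2.
have c0 : 0 < c.
  have := ln_sub_ge (ltr01 : 0 < 1 :> R) (ler1n _ 4 : 1 <= 4 :> R).
  by rewrite ln1 /c; lra.
have sigma_ge0 S : 0 <= sigma E p S.
  by apply: sumr_ge0 => phi _; rewrite mulr_ge0 ?prob_ge0.
have policy_le pi : in_Pi E k pi ->
    sigma_pol E p pi <= 2 * expR 1 / (expR 1 - 1) * OPT_N E p k.
  move=> piP; set s := sigma_pol E p pi.
  have s0 : 0 <= s by apply: sumr_ge0 => phi _; rewrite mulr_ge0 ?prob_ge0.
  have gain_ge0 S v : sigma E p S <= sigma E p (v |: S).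
    by rewrite !sigma_hit; apply: ler_sum => u _; apply: hit_setU1_ge.
  (* B = 9/16 s / c is the influence of [S] at which [sigma_pol_le] no longer promises any gain. *)
  have B0 : 0 <= 9 / 16 * s / c by apply: divr_ge0; [apply: mulr_ge0 => //; lra | exact: ltW].
  have step S : exists v, sigma E p S <= sigma E p (v |: S) /\
      c * (9 / 16 * s / c - sigma E p S) <= k%:R * (sigma E p (v |: S) - sigma E p S).
    pose gain v := sigma E p (v |: S) - sigma E p S.
    case: (@arg_maxP _ _ _ r xpredT gain isT) => v _ max_v; exists v; split => //.
    have -> : c * (9 / 16 * s / c - sigma E p S) = 9 / 16 * s - c * sigma E p S.
      by field; rewrite gt_eqF.
    rewrite lerBlDl; apply: le_trans (sigma_pol_le p01 E_fun E_acyclic pi S) _.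
    rewrite lerD2l; apply: (@le_trans _ _ (\sum_w seed_prob E p pi w * gain v)).
      by apply: ler_sum => w _; apply: ler_wpM2l; [exact: mean_ge0 | exact: max_v].
    (* The seed probabilities sum to the expected number of seeds, at most [k]. *)
    rewrite -mulr_suml; apply: ler_wpM2r; first by rewrite subr_ge0.
    rewrite -mean_sum -[leRHS](mean_cst E p); apply: le_mean => // phi phiE.
    apply: le_trans (_ : #|policy_seeds pi E phi|%:R <= _); last by rewrite ler_nat piP.
    by rewrite -sum1_card natr_sum [leRHS]big_mkcond; apply: ler_sum => w _; case: ifP.
  have [S Sk] := greedy_seeds k1 (sigma_ge0 finset.set0) B0 (ltW c0) step.
  move/le_trans => /(_ _ (sigma_le_OPT_N _ _ Sk)).
  have := gap_constant_le R; rewrite -/c; set d := 1 - expR (- c) => const opt.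
  rewrite mulrAC ler_pdivlMr ?subr_gt0 //.
  have e2 : 0 <= 2 * expR 1 :> R by rewrite mulr_ge0 ?expR_ge0.
  have := ler_wpM2l e2 opt; apply: le_trans.
  rewrite -(ler_pM2l c0).
  have -> : c * (2 * expR 1 * (d * (9 / 16 * s / c))) = 9 / 16 * d * (2 * expR 1) * s.
    by field; rewrite gt_eqF.
  have -> : c * (s * (expR 1 - 1)) = c * (expR 1 - 1) * s by ring.
  exact: ler_wpM2r.
(* The single seed [r] reaches at least itself, so the denominator is positive. *)
have opt_ge : 1 <= OPT_N E p k.
  apply: le_trans (sigma_le_OPT_N E p (_ : #|[set r]| <= k)%N); last by rewrite cards1.
  rewrite -(prob_total E p) /sigma; apply: ler_sum => phi _; rewrite ler_peMr ?prob_ge0 //.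
  rewrite ler1n; apply/card_gt0P; exists r; apply/reachP; exists r => //; exact: set11.
rewrite ler_pdivrMr; last exact: lt_le_trans opt_ge.
apply: ge_sup.
  (* The policy that stops at once shows that the supremum is over a nonempty set. *)
  exists (sigma_pol E p (fun=> None)); exists (fun=> None) => //= phi _.
  rewrite /policy_seeds (_ : iter _ _ _ = finset.set0) ?cards0 //.
  by elim: #|V| => //= n ->.
by move=> _ [pi piP <-]; apply: policy_le.
Qed.
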